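(* Let $\gamma\ge 0$ and let $f\in \dot H^{-2}(\Omega)\setminus\mathbb{S}_\gamma$ be time-independent. Let $T,\tilde T>0$ and $u_0,\tilde u_0\in L^2(\Omega)\cap\mathbb{S}_{\gamma+1}$, and let $u$, $\tilde u$ be the solutions of problem (P) with source $f$ and initial data $u_0$, $\tilde u_0$ respectively. If $u(T)=\tilde u(\tilde T)$, then $T=\tilde T$ and $u_0=\tilde u_0$.
   Context: Let $\Omega\subset\mathbb{R}^d$ ($d=1,2,3$) be an open bounded smooth domain, $\alpha\in(0,1)$, and $q\in L^\infty(\Omega)$, $q\ge 0$, a fixed known potential. Let $A=-\Delta+q$ with zero Dirichlet boundary condition on $L^2(\Omega)$, with eigenvalues $0<\lambda_1\le\lambda_2\le\dots\to\infty$ (multiplicity counted) and $L^2(\Omega)$-orthonormal eigenfunctions $\{\varphi_n\}$. For $s\ge0$, $\dot H^s(\Omega)=\{v\in L^2(\Omega):\|v\|_{\dot H^s}^2=\sum_n\lambda_n^s(v,\varphi_n)^2<\infty\}$, and $\dot H^{-s}(\Omega)$ is its dual; $(\cdot,\cdot)$ denotes the $L^2$ inner product and the duality pairing. The Mittag-Leffler function is $E_{\alpha,\beta}(z)=\sum_{k\ge0}z^k/\Gamma(k\alpha+\beta)$. Define $F(t)v=\sum_n E_{\alpha,1}(-\lambda_nt^\alpha)(v,\varphi_n)\varphi_n$ and $E(t)v=\sum_n t^{\alpha-1}E_{\alpha,\alpha}(-\lambda_nt^\alpha)(v,\varphi_n)\varphi_n$. Problem (P) is $\partial_t^\alpha u-\Delta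 u+qu=f$ in $\Omega\times(0,\infty)$, $u=0$ on $\partial\Omega$, $u(0)=u_0$, where $\partial_t^\alpha u(t)=\frac1{\Gamma(1-\alpha)}\int_0^t(t-s)^{-\alpha}u'(s)\,ds$ is the Caputo derivative; its solution is $u(t)=F(t)u_0+\int_0^tE(t-s)f(s)\,ds$, which for time-independent $f$ equals $F(t)u_0+A^{-1}(I-F(t))f$. For $\gamma\ge -1$, $\mathbb{S}_\gamma=\{v\in\dot H^{-2}(\Omega):\lim_{n\to\infty}\lambda_n^\gamma|(v,\varphi_n)|=0\}$. *)

(* Defs.v *)
From Stdlib Require Import Reals.
From Coquelicot Require Import Coquelicot.
Open Scope R_scope.

Definition Gamma (x : R) : R :=
  RInt_gen (fun t => Rpower t (x - 1) * exp (- t)) (at_right 0) (Rbar_locally p_infty).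

Definition ML (a b z : R) : R :=
  Series (fun k => z ^ k / Gamma (INR k * a + b)).

(* Spectral data of A = -Delta + q (Dirichlet): eigenvalues lambda_1 <= lambda_2 <= ...,
   indexed from 0 here, positive, tending to infinity (multiplicity counted). *)
Definition dirichlet_spectrum (lam : nat -> R) : Prop :=
  0 < lam 0%nat /\ (forall n, lam n <= lam (S n)) /\ is_lim_seq lam p_infty.

(* An element v of \dot H^s is represented by its coefficient sequence c n = (v, phi_n). *)
Definition in_L2 (c : nat -> R) : Prop := ex_series (fun n => (c n) ^ 2).

Definition in_Hdot_m2 (lam : nat -> R) (c : nat -> R) : Prop :=
  ex_series (fun n => / (lam n) ^ 2 * (c n) ^ 2).

Definition in_S (lam : nat -> R) (g : R) (c : nat -> R) : Prop :=
  in_Hdot_m2 lam c /\ is_lim_seq (fun n => Rpower (lam n) g * Rabs (c n)) 0.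

(* Coefficients of the solution of (P) with time-independent source f at time t > 0:
   u(t) = F(t) u0 + A^{-1} (I - F(t)) f. *)
Definition solP (alpha : R) (lam : nat -> R) (u0 f : nat -> R) (t : R) (n : nat) : R :=
  ML alpha 1 (- lam n * Rpower t alpha) * u0 n
  + / lam n * (1 - ML alpha 1 (- lam n * Rpower t alpha)) * f n.

(* Main.v *)
Require Import Defs.
From Stdlib Require Import Reals Factorial Wf_nat Lra Lia.
From Coquelicot Require Import Coquelicot.
Open Scope R_scope.

(** Write [phi x = ML alpha 1 (- x)]. If the two states agree at times [T < T'], then for every [n]
    [lam n (E - E') f n = (lam n E) (lam n u0 n) - (lam n E') (lam n u0' n)] with
    [E = phi (lam n T ^ alpha)] and [E' = phi (lam n T' ^ alpha)]. If [x phi x] is bounded and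
    [x (phi (p x) - phi (q x))] is bounded away from zero for [p < q] and large [x], the decay of
    [lam ^ (g + 1) u0] and [lam ^ (g + 1) u0'] passes to [lam ^ g f], which is excluded. For
    [T = T'], positivity of [phi] gives [u0 = u0'].

    All this follows from
    [1 / (1 + Gamma (1 - alpha) x) <= phi x <= 1 / (1 + x / Gamma (1 + alpha))] and
    [(y - x) phi x (1 - phi y) <= y (phi x - phi y)] for [x <= y], which pass to the limit from a
    discretisation: [phi x] is the limit, for [mu = x / (n + 1) ^ alpha], of the coefficient [U_n]
    of [z ^ n] in [(1 - z) ^ (alpha - 1) / ((1 - z) ^ alpha + mu)]. The coefficients [W_n] of
    [1 / ((1 - z) ^ alpha + mu)] are nonnegative because those of [1 - (1 - z) ^ alpha] are, and
    [1 - U_n = mu (W_0 + ... + W_n)], so [U_n] is nonincreasing. Each of the three inequalities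
    is then an instance of [b_n (w_0 + ... + w_n) <= b_0 w_n + ... + b_n w_0], valid for
    nonincreasing [b] and nonnegative [w]. *)

(** * Exponentials and real powers *)

Lemma exp_le (x y : R) : x <= y -> exp x <= exp y.
Proof. intros [H | ->]; [left; now apply exp_increasing | lra]. Qed.

Lemma ln_le_sub_1 (x : R) : 0 < x -> ln x <= x - 1.
Proof.
  intros Hx. pose proof (exp_ineq1_le (ln x)) as H.
  rewrite exp_ln in H by easy. lra.
Qed.

Lemma Rpower_pos (x y : R) : 0 < Rpower x y.
Proof. apply exp_pos. Qed.

Lemma Rpower_div (x y p : R) : 0 < x -> 0 < y -> Rpower (x / y) p = Rpower x p / Rpower y p.
Proof.
  intros Hx Hy. unfold Rdiv. rewrite <- Rpower_Ropp. unfold Rpower.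
  rewrite ln_mult, ln_Rinv, <- exp_plus by (try apply Rinv_0_lt_compat; easy).
  f_equal. ring.
Qed.

Lemma is_derive_Rpower (p t : R) : 0 < t ->
  is_derive (fun x => Rpower x p) t (p * Rpower t (p - 1)).
Proof. intros Ht. apply is_derive_Reals. now apply derivable_pt_lim_power. Qed.

Lemma continuous_Rpower (p t : R) : 0 < t -> continuous (fun x => Rpower x p) t.
Proof.
  intros Ht. apply @ex_derive_continuous. eexists. now apply is_derive_Rpower.
Qed.

Lemma continuous_exp_opp (t : R) : continuous (fun x => exp (- x)) t.
Proof. apply @ex_derive_continuous. auto_derive. easy. Qed.

Lemma Rpower_exp_opp_le_max (p t : R) : 0 < p -> 0 < t ->
  Rpower t p * exp (- t) <= Rpower p p * exp (- p).
Proof.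
  intros Hp Ht. unfold Rpower. rewrite <- !exp_plus. apply exp_le.
  pose proof (ln_le_sub_1 (t / p) (Rdiv_lt_0_compat _ _ Ht Hp)) as H.
  rewrite ln_div in H by easy.
  apply Rmult_le_compat_l with (r := p) in H; [| lra].
  replace (p * (t / p - 1)) with (t - p) in H by (field; lra). lra.
Qed.

Lemma Rpower_le_affine (u c : R) : 0 < u -> 0 <= c <= 1 -> Rpower u c <= 1 - c + c * u.
Proof.
  intros Hu Hc. set (w := 1 - c + c * u).
  assert (Hw : 0 < w) by (unfold w; destruct (Rle_dec c (/ 2)); nra).
  rewrite <- (exp_ln w) by easy. apply exp_le.
  pose proof (ln_le_sub_1 (u / w) (Rdiv_lt_0_compat _ _ Hu Hw)) as Hu'.
  pose proof (ln_le_sub_1 (1 / w) (Rdiv_lt_0_compat _ _ Rlt_0_1 Hw)) as H1.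
  rewrite ln_div in Hu', H1 by lra. rewrite ln_1 in H1.
  assert (c * (u / w - 1) + (1 - c) * (1 / w - 1) = 0) by (unfold w; field; fold w; lra).
  nra.
Qed.

Lemma is_derive_Rpower_ratio (x t : R) : 0 < t ->
  is_derive (fun s => Rpower (s / (1 + s)) x) t
    (x * (Rpower t (x - 1) * Rpower (1 + t) (- (x + 1)))).
Proof.
  intros Ht. assert (0 < t / (1 + t)) by (apply Rdiv_lt_0_compat; lra).
  pose proof (Rpower_pos (1 + t) (x - 1)).
  evar_last.
  - apply (is_derive_comp (fun s => Rpower s x) (fun s => s / (1 + s)));
      [now apply is_derive_Rpower |].
    auto_derive; [lra | reflexivity].
  - unfold scal; simpl; unfold mult; simpl.
    replace (- (x + 1)) with (- (x - 1) + - INR 2) by (simpl; ring).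
    rewrite Rpower_plus, !Rpower_Ropp, Rpower_pow, Rpower_div by lra. field. lra.
Qed.

Lemma Rpower_ratio_bounds (x t : R) : 0 <= x -> 0 < t -> 0 < Rpower (t / (1 + t)) x <= 1.
Proof.
  intros Hx Ht. split; [apply Rpower_pos |].
  replace 1 with (Rpower 1 x) at 2 by (unfold Rpower; rewrite ln_1, Rmult_0_r; apply exp_0).
  apply Rle_Rpower_l; [easy |]. split; [apply Rdiv_lt_0_compat; lra |].
  apply Rmult_le_reg_r with (1 + t); [lra |]. field_simplify; lra.
Qed.

Lemma filterlim_exp_opp_0 : filterlim (fun t => exp (- t)) (at_right 0) (locally 1).
Proof.
  apply (filterlim_filter_le_1 (F := locally 0) _ (filter_le_within _)).
  replace 1 with (exp (- 0)) by (rewrite Ropp_0; apply exp_0). apply continuous_exp_opp.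
Qed.

Lemma filterlim_Rpower_0 (p : R) : 0 < p ->
  filterlim (fun t => Rpower t p) (at_right 0) (locally 0).
Proof.
  intros Hp. apply (filterlim_comp _ _ _ (fun t => p * ln t) exp _ (Rbar_locally m_infty));
    [| exact is_lim_exp_m].
  apply (filterlim_comp _ _ _ ln (Rmult p) _ (Rbar_locally m_infty)); [exact is_lim_ln_0 |].
  pose proof (filterlim_Rbar_mult_l p m_infty) as H.
  replace (Rbar_mult p m_infty) with m_infty in H; [exact H |].
  symmetry. apply is_Rbar_mult_unique, is_Rbar_mult_sym, is_Rbar_mult_m_infty_pos. easy.
Qed.

(** * Integrals over the positive half-line *)

Local Notation is_RInt_half_line f :=
  (is_RInt_gen f (at_right 0) (Rbar_locally p_infty)).

Lemma filter_prod_half_line (a b : R) : 0 < a ->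
  filter_prod (at_right 0) (Rbar_locally p_infty)
    (fun I : R * R => 0 < fst I < a /\ b < snd I).
Proof.
  intros Ha.
  apply (Filter_prod _ _ _ (fun t => 0 < t < a) (fun t => b < t)); [| now exists b | easy].
  exists (mkposreal a Ha). intros t Ht Ht0.
  change (Rabs (t + - 0) < a) in Ht. apply Rabs_def2 in Ht. lra.
Qed.

Lemma is_RInt_half_line_le (f g : R -> R) (lf lg : R) :
  (forall t, 0 < t -> 0 <= f t <= g t) ->
  is_RInt_half_line f lf -> is_RInt_half_line g lg -> lf <= lg.
Proof.
  intros Hfg Hf Hg. apply Rle_trans with (Rabs lf); [apply Rle_abs |].
  apply (RInt_gen_norm (V := R_CompleteNormedModule)
    (Fa := at_right 0) (Fb := Rbar_locally p_infty) f g lf lg); [| | exact Hf | exact Hg];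
    generalize (filter_prod_half_line 1 1 Rlt_0_1); apply filter_imp;
    intros [a b]; simpl; intros HI; [lra |].
  intros t Ht. change (Rabs (f t) <= g t). rewrite Rabs_pos_eq; apply Hfg; lra.
Qed.

Lemma RInt_le_superset (f : R -> R) (a b c d : R) :
  a <= b -> b <= c -> c <= d ->
  (forall t, a <= t <= d -> continuous f t) -> (forall t, a <= t <= d -> 0 <= f t) ->
  RInt f b c <= RInt f a d.
Proof.
  intros Hab Hbc Hcd Hcont Hpos.
  assert (Hex : forall s t, a <= s -> s <= t -> t <= d -> ex_RInt f s t).
  { intros s t Hs Hst Ht. apply @ex_RInt_continuous. intros z Hz. apply Hcont.
    rewrite Rmin_left, Rmax_right in Hz; lra. }
  assert (Hge : forall s t, a <= s -> s <= t -> t <= d -> 0 <= RInt f s t).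
  { intros s t Hs Hst Ht. apply RInt_ge_0; [easy | now apply Hex |].
    intros z Hz. apply Hpos. lra. }
  rewrite <- (RInt_Chasles f a b d), <- (RInt_Chasles f b c d) by (apply Hex; lra).
  pose proof (Hge a b). pose proof (Hge c d). unfold plus; simpl. lra.
Qed.

Lemma RInt_le_derive (f F dF : R -> R) (a b : R) : a <= b ->
  (forall t, a <= t <= b -> continuous f t) ->
  (forall t, a <= t <= b -> continuous dF t) ->
  (forall t, a <= t <= b -> is_derive F t (dF t)) ->
  (forall t, a <= t <= b -> f t <= dF t) ->
  RInt f a b <= F b - F a.
Proof.
  intros Hab Hf HdF HF Hle.
  assert (HI : is_RInt dF a b (minus (F b) (F a))).
  { apply (is_RInt_derive F dF); intros t Ht; rewrite Rmin_left, Rmax_right in Ht by easy;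
      [now apply HF | now apply HdF]. }
  change (F b - F a) with (minus (F b) (F a)). rewrite <- (is_RInt_unique _ _ _ _ HI).
  apply RInt_le; [easy | | eexists; eassumption | intros t Ht; apply Hle; lra].
  apply @ex_RInt_continuous. intros t Ht. apply Hf.
  now rewrite Rmin_left, Rmax_right in Ht by easy.
Qed.

Lemma is_RInt_half_line_sup (f : R -> R) (M : R) :
  (forall t, 0 < t -> continuous f t) -> (forall t, 0 < t -> 0 <= f t) ->
  (forall a b, 0 < a -> a <= b -> RInt f a b <= M) ->
  exists l, is_RInt_half_line f l /\ forall a b, 0 < a -> a <= b -> RInt f a b <= l.
Proof.
  intros Hcont Hpos HM.
  destruct (completeness (fun v => exists a b, 0 < a /\ a <= b /\ v = RInt f a b))
    as [l [Hub Hlub]].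
  - exists M. intros v (a & b & Ha & Hab & ->). now apply HM.
  - exists (RInt f 1 1), 1, 1. repeat split; lra.
  - assert (Hle : forall a b, 0 < a -> a <= b -> RInt f a b <= l).
    { intros a b Ha Hab. apply Hub. now exists a, b. }
    exists l. split; [| exact Hle]. intros P [eps HP].
    assert (exists a b, 0 < a /\ a <= b /\ l - eps < RInt f a b)
      as (a & b & Ha & Hab & Hgt).
    { apply Classical_Prop.NNPP. intros Hno. assert (l <= l - eps).
      { apply Hlub. intros v (a & b & Ha & Hab & ->).
        apply Rnot_lt_le. intros Hv. apply Hno. now exists a, b. }
      pose proof (cond_pos eps). lra. }
    unfold filtermapi. generalize (filter_prod_half_line a b Ha). apply filter_imp.
    intros [s t]; simpl; intros [Hs Ht]. exists (RInt f s t). split.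
    + apply (RInt_correct f), @ex_RInt_continuous. intros z Hz. apply Hcont.
      rewrite Rmin_left in Hz; lra.
    + apply HP. change (Rabs (RInt f s t + - l) < eps).
      assert (RInt f a b <= RInt f s t)
        by (apply RInt_le_superset; intros; try apply Hcont; try apply Hpos; lra).
      assert (RInt f s t <= l) by (apply Hle; lra).
      apply Rabs_def1; lra.
Qed.

Lemma is_RInt_half_line_derive (F dF : R -> R) (la lb : R) :
  (forall t, 0 < t -> is_derive F t (dF t)) ->
  (forall t, 0 < t -> continuous dF t) ->
  filterlim F (at_right 0) (locally la) ->
  filterlim F (Rbar_locally p_infty) (locally lb) ->
  is_RInt_half_line dF (lb - la).
Proof.
  intros HF HdF Ha Hb.
  assert (HD : forall t, 0 < t -> Derive F t = dF t)
    by (intros t Ht; now apply is_derive_unique, HF).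
  pose proof (filter_prod_half_line 1 1 Rlt_0_1) as HI.
  apply (is_RInt_gen_ext (Derive F)).
  - revert HI. apply filter_imp. intros [a b]; simpl; intros HI t Ht. apply HD.
    rewrite Rmin_left in Ht; lra.
  - apply is_RInt_gen_Derive; [| | easy | easy]; revert HI; apply filter_imp;
      intros [a b]; simpl; intros HI t Ht; rewrite Rmin_left in Ht by lra.
    + eexists. apply HF. lra.
    + assert (Ht0 : 0 < t) by lra.
      apply (continuous_ext_loc _ dF); [| now apply HdF].
      exists (mkposreal t Ht0). intros y Hy. symmetry. apply HD.
      change (Rabs (y + - t) < t) in Hy. apply Rabs_def2 in Hy. lra.
Qed.

(** * The Gamma function on the positive half-line *)

Definition Gamma_integrand (x t : R) : R := Rpower t (x - 1) * exp (- t).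

Lemma Gamma_integrand_pos (x t : R) : 0 < Gamma_integrand x t.
Proof. apply Rmult_lt_0_compat; apply exp_pos. Qed.

Lemma Gamma_integrand_plus (x c t : R) :
  Gamma_integrand (x + c) t = Rpower t c * Gamma_integrand x t.
Proof.
  unfold Gamma_integrand. replace (x + c - 1) with (c + (x - 1)) by ring.
  rewrite Rpower_plus. ring.
Qed.

Lemma continuous_Gamma_integrand (x t : R) : 0 < t -> continuous (Gamma_integrand x) t.
Proof.
  intros Ht. apply @continuous_mult; [now apply continuous_Rpower | apply continuous_exp_opp].
Qed.

(* Up to a constant, the derivative of the bounded function [(t / (1 + t)) ^ x] dominates the
   integrand both at [0] and at infinity. *)
Lemma RInt_Gamma_bounded (x : R) : 0 < x ->
  exists M, forall a b, 0 < a -> a <= b -> RInt (Gamma_integrand x) a b <= M.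
Proof.
  intros Hx. set (C := Rpower (x + 1) (x + 1) * exp (- (x + 1)) * exp 1 / x).
  assert (HC : 0 < C)
    by (apply Rdiv_lt_0_compat; [repeat apply Rmult_lt_0_compat; apply exp_pos | easy]).
  exists C. intros a b Ha Hab.
  apply Rle_trans with (C * Rpower (b / (1 + b)) x - C * Rpower (a / (1 + a)) x).
  - apply (RInt_le_derive _ (fun t => C * Rpower (t / (1 + t)) x)
      (fun t => C * (x * (Rpower t (x - 1) * Rpower (1 + t) (- (x + 1)))))); [easy | | | |];
      intros t Ht.
    + apply continuous_Gamma_integrand. lra.
    + repeat apply @continuous_mult; try apply continuous_const;
        [apply continuous_Rpower; lra |].
      apply (continuous_comp (fun s => 1 + s) (fun s => Rpower s (- (x + 1))));
        [apply @ex_derive_continuous; auto_derive; easy | apply continuous_Rpower; lra].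
    + apply is_derive_scal, is_derive_Rpower_ratio. lra.
    + pose proof (Rpower_exp_opp_le_max (x + 1) (1 + t) ltac:(lra) ltac:(lra)) as H.
      assert (Hexp : exp (- t) <= C * x * Rpower (1 + t) (- (x + 1))).
      { rewrite Rpower_Ropp. pose proof (Rpower_pos (1 + t) (x + 1)).
        apply Rmult_le_reg_l with (Rpower (1 + t) (x + 1)); [easy |].
        replace (exp (- t)) with (exp (- (1 + t)) * exp 1)
          by (rewrite <- exp_plus; f_equal; ring).
        rewrite <- Rmult_assoc.
        eapply Rle_trans; [apply Rmult_le_compat_r; [left; apply exp_pos | exact H] |].
        right. unfold C. field. lra. }
      unfold Gamma_integrand. pose proof (Rpower_pos t (x - 1)). nra.
  - pose proof (Rpower_ratio_bounds x a ltac:(lra) Ha).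
    pose proof (Rpower_ratio_bounds x b ltac:(lra) ltac:(lra)). nra.
Qed.

Lemma Gamma_eq (x l : R) : is_RInt_half_line (Gamma_integrand x) l -> Gamma x = l.
Proof. exact (is_RInt_gen_unique (Gamma_integrand x) l). Qed.

Lemma is_RInt_Gamma_sup (x : R) : 0 < x ->
  is_RInt_half_line (Gamma_integrand x) (Gamma x) /\
  forall a b, 0 < a -> a <= b -> RInt (Gamma_integrand x) a b <= Gamma x.
Proof.
  intros Hx. destruct (RInt_Gamma_bounded x Hx) as [M HM].
  destruct (is_RInt_half_line_sup (Gamma_integrand x) M) as (l & Hl & Hle); [| | exact HM |].
  - apply continuous_Gamma_integrand.
  - intros t _. left. apply Gamma_integrand_pos.
  - now rewrite (Gamma_eq x l Hl).
Qed.

Lemma is_RInt_Gamma (x : R) : 0 < x -> is_RInt_half_line (Gamma_integrand x) (Gamma x).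
Proof. apply is_RInt_Gamma_sup. Qed.

Lemma Gamma_pos (x : R) : 0 < x -> 0 < Gamma x.
Proof.
  intros Hx. apply Rlt_le_trans with (RInt (Gamma_integrand x) 1 2).
  - apply RInt_gt_0; [lra | intros; apply Gamma_integrand_pos |].
    intros. apply continuous_Gamma_integrand. lra.
  - apply is_RInt_Gamma_sup; lra.
Qed.

Lemma filterlim_Gamma_integrand_0 (x : R) : 1 < x ->
  filterlim (Gamma_integrand x) (at_right 0) (locally 0).
Proof.
  intros Hx. assert (Hx1 : 0 < x - 1) by lra.
  pose proof (filterlim_comp_2 _ _ _ (filterlim_Rpower_0 (x - 1) Hx1) filterlim_exp_opp_0
    (filterlim_mult (K := R_AbsRing) 0 1)) as H.
  change (mult 0 1) with (0 * 1) in H. now rewrite Rmult_0_l in H.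
Qed.

Lemma filterlim_Gamma_integrand_p_infty (x : R) : 0 < x ->
  filterlim (Gamma_integrand x) (Rbar_locally p_infty) (locally 0).
Proof.
  intros Hx. set (C := Rpower x x * exp (- x)).
  apply (is_lim_le_le_loc (fun _ => 0) (fun t => C * / t) _ p_infty 0).
  - exists 0. intros t Ht. split; [left; apply Gamma_integrand_pos |].
    pose proof (Rpower_exp_opp_le_max x t Hx Ht) as H. fold C in H.
    apply Rmult_le_reg_r with t; [easy |].
    rewrite (Rmult_assoc C), Rinv_l by lra. unfold Gamma_integrand.
    replace x with (x - 1 + 1) in H at 1 by ring.
    rewrite Rpower_plus, Rpower_1 in H by easy. lra.
  - apply is_lim_const.
  - replace 0 with (C * 0) by ring.
    apply (is_lim_scal_l (fun t => / t) C p_infty 0).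
    apply (is_lim_inv (fun t => t) p_infty p_infty); [apply is_lim_id | easy].
Qed.

Lemma is_derive_Gamma_integrand (x t : R) : 0 < t ->
  is_derive (Gamma_integrand (x + 1)) t (x * Gamma_integrand x t - Gamma_integrand (x + 1) t).
Proof.
  intros Ht. unfold Gamma_integrand. replace (x + 1 - 1) with x by ring. evar_last.
  - apply (is_derive_mult (K := R_AbsRing) (fun t => Rpower t x) (fun t => exp (- t)));
      [now apply is_derive_Rpower | | apply Rmult_comm].
    auto_derive; [easy | reflexivity].
  - unfold plus, mult; simpl. ring.
Qed.

Lemma Gamma_plus_1 (x : R) : 0 < x -> Gamma (x + 1) = x * Gamma x.
Proof.
  intros Hx. assert (Hx1 : 0 < x + 1) by lra.
  assert (Hparts : is_RInt_half_line
    (fun t => x * Gamma_integrand x t - Gamma_integrand (x + 1) t) (0 - 0)).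
  { apply (is_RInt_half_line_derive (Gamma_integrand (x + 1))).
    - intros t. apply is_derive_Gamma_integrand.
    - intros t Ht. apply @continuous_minus; [apply @continuous_mult; [apply continuous_const |] |];
        now apply continuous_Gamma_integrand.
    - apply filterlim_Gamma_integrand_0. lra.
    - now apply filterlim_Gamma_integrand_p_infty. }
  pose proof (is_RInt_gen_minus _ _ _ _
    (is_RInt_gen_scal _ x _ (is_RInt_Gamma x Hx)) (is_RInt_Gamma (x + 1) Hx1)) as Hdiff.
  pose proof (eq_trans (eq_sym (is_RInt_gen_unique _ _ Hdiff)) (is_RInt_gen_unique _ _ Hparts))
    as H.
  unfold minus, plus, opp, scal in H; simpl in H; unfold mult in H; simpl in H. lra.
Qed.

Lemma Gamma_integrand_1 (t : R) : 0 < t -> Gamma_integrand 1 t = exp (- t).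
Proof.
  intros Ht. unfold Gamma_integrand. replace (1 - 1) with 0 by ring.
  rewrite Rpower_O by easy. ring.
Qed.

Lemma Gamma_1 : Gamma 1 = 1.
Proof.
  replace 1 with (- 0 - - 1) at 2 by ring. apply Gamma_eq.
  apply (is_RInt_half_line_derive (fun t => - exp (- t))).
  - intros t Ht. rewrite Gamma_integrand_1 by easy. auto_derive; [easy | ring].
  - intros t. apply continuous_Gamma_integrand.
  - apply (filterlim_comp _ _ _ _ Ropp _ _ _ filterlim_exp_opp_0
      (filterlim_opp (1 : R_NormedModule))).
  - apply (filterlim_comp _ _ _ (fun t => exp (- t)) Ropp _ (locally 0));
      [| apply (filterlim_opp (0 : R_NormedModule))].
    apply (filterlim_ext_loc (Gamma_integrand 1)).
    + exists 0. exact Gamma_integrand_1.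
    + apply filterlim_Gamma_integrand_p_infty. lra.
Qed.

(* Integrate the tangent line of the concave function [t ^ c] at [t = x]. *)
Lemma Gamma_plus_le (x c : R) : 0 < x -> 0 <= c <= 1 ->
  Gamma (x + c) <= Rpower x c * Gamma x.
Proof.
  intros Hx Hc. assert (Hx1 : 0 < x + 1) by lra.
  pose proof (is_RInt_gen_scal _ ((1 - c) * Rpower x c) _ (is_RInt_Gamma x Hx)) as Hconst.
  pose proof (is_RInt_gen_scal _ (c * Rpower x c / x) _ (is_RInt_Gamma (x + 1) Hx1)) as Hlin.
  pose proof (is_RInt_gen_plus _ _ _ _ Hconst Hlin) as Htangent. clear Hconst Hlin.
  rewrite Gamma_plus_1 in Htangent by easy.
  replace (Rpower x c * Gamma x) with
    (plus (scal ((1 - c) * Rpower x c) (Gamma x)) (scal (c * Rpower x c / x) (x * Gamma x)))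
    by (unfold plus, scal; simpl; unfold mult; simpl; field; lra).
  refine (is_RInt_half_line_le _ _ _ _ _ (is_RInt_Gamma (x + c) ltac:(lra)) Htangent).
  intros t Ht. split; [left; apply Gamma_integrand_pos |].
  unfold plus, scal; simpl; unfold mult; simpl.
  rewrite !Gamma_integrand_plus, Rpower_1 by easy.
  assert (Htan : Rpower t c <= Rpower x c * (1 - c + c * (t / x))).
  { pose proof (Rpower_le_affine (t / x) c (Rdiv_lt_0_compat _ _ Ht Hx) Hc) as H.
    rewrite Rpower_div in H by easy. pose proof (Rpower_pos x c).
    apply Rmult_le_compat_l with (r := Rpower x c) in H; [| lra].
    eapply Rle_trans; [| exact H]. right. field. lra. }
  eapply Rle_trans; [apply Rmult_le_compat_r; [left; apply Gamma_integrand_pos | exact Htan] |].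
  right. field. lra.
Qed.

(** * Cauchy products *)

Lemma PS_mult_comm (a b : nat -> R) (n : nat) : PS_mult a b n = PS_mult b a n.
Proof.
  unfold PS_mult. rewrite <- sum_f_R0_skip. apply sum_eq. intros k Hk.
  replace (n - (n - k))%nat with k by lia. ring.
Qed.

Lemma PS_mult_ext_r (a b b' : nat -> R) (n : nat) :
  (forall k, b k = b' k) -> PS_mult a b n = PS_mult a b' n.
Proof. intros Hb. apply sum_eq. intros k _. now rewrite Hb. Qed.

Lemma PS_mult_sub_scal (a b d : nat -> R) (c : R) (n : nat) :
  PS_mult a (fun k => b k - c * d k) n = PS_mult a b n - c * PS_mult a d n.
Proof.
  unfold PS_mult. rewrite scal_sum, <- minus_sum. apply sum_eq. intros; ring.
Qed.

Lemma PS_mult_decreasing_ge (b w : nat -> R) (n : nat) :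
  Un_decreasing b -> (forall k, 0 <= w k) -> b n * sum_f_R0 w n <= PS_mult b w n.
Proof.
  intros Hb Hw. rewrite PS_mult_comm, scal_sum. apply sum_Rle. intros k Hk.
  apply Rmult_le_compat_l; [apply Hw |]. apply decreasing_prop; [exact Hb | lia].
Qed.

(** * Coefficients of [(1 - z) ^ (- c)] *)

Fixpoint multichoose (c : R) (n : nat) : R :=
  match n with
  | O => 1
  | S m => multichoose c m * (c + INR m) / INR (S m)
  end.

Lemma INR_S_pos (n : nat) : 0 < INR (S n).
Proof. apply lt_0_INR. lia. Qed.

Lemma multichoose_S_mul (c : R) (n : nat) :
  INR (S n) * multichoose c (S n) = multichoose c n * (c + INR n).
Proof. cbn [multichoose]. field. pose proof (INR_S_pos n). lra. Qed.

Lemma multichoose_1 (n : nat) : multichoose 1 n = 1.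
Proof.
  induction n as [| n IH]; [easy |]. cbn [multichoose]. rewrite IH, S_INR. field.
  pose proof (pos_INR n). lra.
Qed.

Lemma multichoose_0_S (n : nat) : multichoose 0 (S n) = 0.
Proof.
  induction n as [| n IH]; cbn [multichoose] in *; [simpl; field |].
  rewrite IH. unfold Rdiv. ring.
Qed.

Lemma multichoose_nonneg (c : R) (n : nat) : 0 <= c -> 0 <= multichoose c n.
Proof.
  intros Hc. induction n as [| n IH]; [simpl; lra |]. cbn [multichoose].
  apply Rdiv_le_0_compat; [| apply INR_S_pos].
  pose proof (pos_INR n). apply Rmult_le_pos; lra.
Qed.

Lemma multichoose_opp_nonpos (c : R) (n : nat) :
  0 <= c <= 1 -> multichoose (- c) (S n) <= 0.
Proof.
  intros Hc. induction n as [| n IH]; [simpl; lra |].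
  apply Rmult_le_reg_l with (INR (S (S n))); [apply INR_S_pos |].
  rewrite multichoose_S_mul, Rmult_0_r, S_INR. pose proof (pos_INR n). nra.
Qed.

Lemma multichoose_decreasing (c : R) : 0 <= c <= 1 -> Un_decreasing (multichoose c).
Proof.
  intros Hc n. apply Rmult_le_reg_l with (INR (S n)); [apply INR_S_pos |].
  rewrite multichoose_S_mul, S_INR, Rmult_comm.
  apply Rmult_le_compat_r; [now apply multichoose_nonneg | lra].
Qed.

Lemma multichoose_plus_1 (c : R) (n : nat) :
  multichoose (c + 1) n * c = multichoose c n * (c + INR n).
Proof.
  induction n as [| n IH]; [simpl; ring |]. pose proof (INR_S_pos n).
  apply Rmult_eq_reg_l with (INR (S n)); [| lra].
  rewrite <- !Rmult_assoc, !multichoose_S_mul, S_INR.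
  transitivity (multichoose (c + 1) n * c * (c + 1 + INR n)); [ring | rewrite IH; ring].
Qed.

Lemma PS_mult_multichoose (c d : R) (n : nat) :
  PS_mult (multichoose c) (multichoose d) n = multichoose (c + d) n.
Proof.
  unfold PS_mult. induction n as [| n IH]; [simpl; ring |].
  pose proof (INR_S_pos n). apply Rmult_eq_reg_l with (INR (S n)); [| lra].
  rewrite multichoose_S_mul, <- IH.
  transitivity
    (sum_f_R0 (fun k => INR k * multichoose c k * multichoose d (S n - k)) (S n) +
     sum_f_R0 (fun k => multichoose c k * (INR (S n - k) * multichoose d (S n - k))) (S n)).
  { rewrite <- plus_sum, scal_sum. apply sum_eq. intros k Hk.
    rewrite minus_INR by easy. ring. }
  rewrite (decomp_sum (fun k => INR k * _ * _)), (tech5 (fun k => _ * (_ * _))) by lia.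
  rewrite Nat.sub_diag. simpl (INR 0). cbn [Init.Nat.pred].
  rewrite !Rmult_0_l, Rmult_0_r, Rplus_0_l, Rplus_0_r, <- plus_sum.
  rewrite Rmult_comm, scal_sum. apply sum_eq. intros k Hk.
  replace (S n - S k)%nat with (n - k)%nat by lia.
  replace (S n - k)%nat with (S (n - k)) by lia.
  rewrite !multichoose_S_mul, minus_INR by easy. ring.
Qed.

Lemma PS_mult_multichoose_1 (a : nat -> R) (n : nat) :
  PS_mult a (multichoose 1) n = sum_f_R0 a n.
Proof. apply sum_eq. intros k _. rewrite multichoose_1. ring. Qed.

Lemma sum_multichoose (c : R) (n : nat) :
  sum_f_R0 (multichoose c) n = multichoose (c + 1) n.
Proof. now rewrite <- PS_mult_multichoose_1, PS_mult_multichoose. Qed.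

Lemma multichoose_le_plus_1 (c : R) (n : nat) :
  0 <= c -> multichoose c n <= multichoose (c + 1) n.
Proof.
  intros Hc. rewrite <- sum_multichoose. destruct n as [| n]; [simpl; lra |].
  rewrite tech5. pose proof (cond_pos_sum (multichoose c) n
    (fun k => multichoose_nonneg c k Hc)). lra.
Qed.

Lemma is_derive_sum_multichoose_pow (c r : R) (n : nat) : r < 1 ->
  is_derive (fun s => sum_f_R0 (fun j => multichoose c j * s ^ j) n * Rpower (1 - s) c) r
    (- ((c + INR n) * multichoose c n * r ^ n * Rpower (1 - r) (c - 1))).
Proof.
  intros Hr.
  assert (Hpow : is_derive (fun s => Rpower (1 - s) c) r (- c * Rpower (1 - r) (c - 1))).
  { evar_last.
    - apply (is_derive_comp (fun s => Rpower s c) (fun s => 1 - s));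
        [apply is_derive_Rpower; lra |].
      auto_derive; [easy | reflexivity].
    - unfold scal; simpl; unfold mult; simpl. ring. }
  induction n as [| n IH].
  - apply (is_derive_ext (fun s => Rpower (1 - s) c)); [intros s; simpl; ring |].
    replace (- _) with (- c * Rpower (1 - r) (c - 1)) by (simpl; ring). exact Hpow.
  - apply (is_derive_ext (fun s =>
      sum_f_R0 (fun j => multichoose c j * s ^ j) n * Rpower (1 - s) c +
      multichoose c (S n) * s ^ S n * Rpower (1 - s) c));
      [intros s; symmetry; rewrite tech5; apply Rmult_plus_distr_r |].
    evar_last.
    + apply @is_derive_plus; [exact IH |].
      apply (is_derive_mult (fun s => multichoose c (S n) * s ^ S n));
        [| exact Hpow | apply Rmult_comm].
      apply is_derive_scal, (is_derive_pow (fun s => s)), (is_derive_id (K := R_AbsRing)).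
    + assert (Hsplit : Rpower (1 - r) c = Rpower (1 - r) (c - 1) * (1 - r)).
      { rewrite <- (Rpower_1 (1 - r)) at 3 by lra. rewrite <- Rpower_plus. f_equal. ring. }
      generalize (multichoose_S_mul c n). generalize (multichoose c (S n)) (INR (S n)).
      intros m N HS. unfold plus, mult, one; simpl. rewrite Hsplit.
      transitivity (Rpower (1 - r) (c - 1) * r ^ n *
        (- (multichoose c n * (c + INR n)) + N * m * (1 - r) - c * m * r)); [ring |].
      rewrite <- HS. ring.
Qed.

Lemma sum_multichoose_pow_le (c r : R) (n : nat) : 0 <= c -> 0 <= r < 1 ->
  sum_f_R0 (fun j => multichoose c j * r ^ j) n <= Rpower (1 - r) (- c).
Proof.
  intros Hc [Hr0 Hr1]. rewrite Rpower_Ropp. pose proof (Rpower_pos (1 - r) c).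
  apply Rmult_le_reg_r with (Rpower (1 - r) c); [easy |]. rewrite Rinv_l by lra.
  set (h := fun s => sum_f_R0 (fun j => multichoose c j * s ^ j) n * Rpower (1 - s) c).
  assert (Hh0 : h 0 = 1).
  { unfold h. rewrite Rminus_0_r. unfold Rpower. rewrite ln_1, Rmult_0_r, exp_0, Rmult_1_r.
    destruct n as [| n]; [simpl; ring |]. rewrite decomp_sum by lia.
    rewrite (sum_eq_R0 (fun j => _ * 0 ^ S j)); [simpl; ring | intros; simpl; ring]. }
  destruct Hr0 as [Hr0 | <-]; [| fold (h 0); lra].
  destruct (MVT_cor2 h (fun s => - ((c + INR n) * multichoose c n * s ^ n * Rpower (1 - s) (c - 1)))
    0 r Hr0) as (s & Hs & Hs0r).
  - intros s Hs. apply is_derive_Reals, is_derive_sum_multichoose_pow. lra.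
  - fold (h r). rewrite Hh0 in Hs.
    assert (0 <= (c + INR n) * multichoose c n * s ^ n * Rpower (1 - s) (c - 1)).
    { pose proof (pos_INR n). pose proof (multichoose_nonneg c n Hc).
      repeat apply Rmult_le_pos; try apply pow_le; try (left; apply Rpower_pos); lra. }
    nra.
Qed.

Lemma multichoose_plus_1_pow_le (c r : R) (n : nat) : 0 <= c -> 0 <= r < 1 ->
  multichoose (c + 1) n * r ^ n <= Rpower (1 - r) (- c).
Proof.
  intros Hc Hr. eapply Rle_trans; [| now apply (sum_multichoose_pow_le c r n)].
  rewrite <- sum_multichoose, Rmult_comm, scal_sum. apply sum_Rle. intros j Hj.
  apply Rmult_le_compat_l; [now apply multichoose_nonneg |].
  replace n with (j + (n - j))%nat by lia. rewrite pow_add.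
  rewrite <- (Rmult_1_r (r ^ j)) at 2. apply Rmult_le_compat_l; [apply pow_le; lra |].
  rewrite <- (pow1 (n - j)). apply pow_incr. lra.
Qed.

Lemma multichoose_Gamma (c : R) (n : nat) : 0 < c ->
  multichoose c n * Gamma c * INR (fact n) = Gamma (c + INR n).
Proof.
  intros Hc. induction n as [| n IH]; [simpl; rewrite Rplus_0_r; ring |].
  rewrite S_INR, <- Rplus_assoc. pose proof (pos_INR n).
  rewrite Gamma_plus_1, <- IH, fact_simpl, mult_INR by lra.
  transitivity (INR (S n) * multichoose c (S n) * Gamma c * INR (fact n)); [ring |].
  rewrite multichoose_S_mul. ring.
Qed.

Lemma Gamma_fact (n : nat) : Gamma (INR n + 1) = INR (fact n).
Proof. rewrite Rplus_comm, <- multichoose_Gamma, multichoose_1, Gamma_1 by lra. ring. Qed.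

Lemma Gamma_plus_INR_bounds (c : R) (n : nat) : 0 < c <= 1 -> (0 < n)%nat ->
  INR (fact n) <= Gamma (c + INR n) * Rpower (INR (S n)) (1 - c) <=
  INR (S n) / INR n * INR (fact n).
Proof.
  intros Hc Hn. assert (Hn' : 0 < INR n) by now apply lt_0_INR.
  pose proof (Gamma_pos (c + INR n) ltac:(lra)) as HG. rewrite S_INR. split.
  - pose proof (Gamma_plus_le (c + INR n) (1 - c) ltac:(lra) ltac:(lra)) as H.
    replace (c + INR n + (1 - c)) with (INR n + 1) in H by ring.
    rewrite Gamma_fact, Rmult_comm in H. eapply Rle_trans; [exact H |].
    apply Rmult_le_compat_l; [lra |]. apply Rle_Rpower_l; lra.
  - pose proof (Gamma_plus_le (INR n) c Hn' ltac:(lra)) as H.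
    rewrite (Rplus_comm c). rewrite <- Gamma_fact, Gamma_plus_1 by easy.
    pose proof (Gamma_pos (INR n) Hn'). pose proof (Rpower_pos (INR n + 1) (1 - c)).
    apply Rle_trans with (Gamma (INR n) * (Rpower (INR n) c * Rpower (INR n + 1) (1 - c)));
      [nra |].
    apply Rle_trans with (Gamma (INR n) * (INR n + 1)); [| right; field; lra].
    apply Rmult_le_compat_l; [lra |].
    rewrite <- (Rpower_1 (INR n + 1)) at 2 by lra.
    replace 1 with (c + (1 - c)) at 4 by ring. rewrite Rpower_plus.
    apply Rmult_le_compat_r; [lra |]. apply Rle_Rpower_l; lra.
Qed.

Lemma is_lim_seq_INR_ratio (a b : R) : is_lim_seq (fun n => (INR n + a) / (INR n + b)) 1.
Proof.
  apply is_lim_seq_ext_loc with (fun n => 1 + (a - b) * / (INR n + b)).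
  - destruct (INR_unbounded (- b)) as [N HN]. exists N. intros n Hn.
    apply le_INR in Hn. field. lra.
  - replace (Finite 1) with (Finite (1 + (a - b) * 0)) by (f_equal; ring).
    apply is_lim_seq_plus'; [apply is_lim_seq_const |].
    apply (is_lim_seq_scal_l _ (a - b) 0).
    apply (is_lim_seq_inv _ p_infty); [| easy].
    apply (is_lim_seq_plus _ _ p_infty b p_infty);
      [apply is_lim_seq_INR | apply is_lim_seq_const | easy].
Qed.

Lemma Rpos_unit_ind (P : R -> Prop) :
  (forall x, 0 < x <= 1 -> P x) -> (forall x, 0 < x -> P x -> P (x + 1)) ->
  forall x, 0 < x -> P x.
Proof.
  intros Hunit Hstep.
  assert (H : forall n x, 0 < x <= INR n + 1 -> P x).
  { induction n as [| n IH]; intros x Hx; [apply Hunit; simpl in Hx; lra |].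
    destruct (Rle_dec x 1); [apply Hunit; lra |].
    replace x with (x - 1 + 1) by ring. rewrite S_INR in Hx.
    apply Hstep; [lra | apply IH; lra]. }
  intros x Hx. destruct (INR_unbounded x) as [n Hn]. apply (H n). lra.
Qed.

Lemma is_lim_seq_multichoose_unit (c : R) : 0 < c <= 1 ->
  is_lim_seq (fun n => multichoose c n * Rpower (INR (S n)) (1 - c)) (/ Gamma c).
Proof.
  intros Hc. pose proof (Gamma_pos c ltac:(lra)) as HG.
  apply (is_lim_seq_le_le_loc (fun _ => / Gamma c) _
    (fun n => / Gamma c * ((INR n + 1) / (INR n + 0)))).
  - exists 1%nat. intros n Hn. pose proof (INR_fact_lt_0 n) as Hfact.
    assert (HGf : 0 < Gamma c * INR (fact n)) by now apply Rmult_lt_0_compat.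
    pose proof (Gamma_plus_INR_bounds c n Hc Hn) as H.
    rewrite Rplus_0_r, <- S_INR. rewrite <- multichoose_Gamma in H by lra.
    set (m := multichoose c n * Rpower (INR (S n)) (1 - c)).
    replace (multichoose c n * Gamma c * INR (fact n) * Rpower (INR (S n)) (1 - c))
      with (m * (Gamma c * INR (fact n))) in H by (unfold m; ring).
    split; apply Rmult_le_reg_r with (Gamma c * INR (fact n)); try easy.
    + eapply Rle_trans; [| apply H]. right. field. lra.
    + eapply Rle_trans; [apply H |]. right. field. split; [| lra].
      apply not_0_INR. lia.
  - apply is_lim_seq_const.
  - replace (Finite (/ Gamma c)) with (Rbar_mult (/ Gamma c) 1) by (simpl; f_equal; ring).
    apply is_lim_seq_scal_l, is_lim_seq_INR_ratio.
Qed.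

Lemma is_lim_seq_multichoose (c : R) : 0 < c ->
  is_lim_seq (fun n => multichoose c n * Rpower (INR (S n)) (1 - c)) (/ Gamma c).
Proof.
  revert c. apply Rpos_unit_ind; [exact is_lim_seq_multichoose_unit |].
  intros c Hc IH. rewrite Gamma_plus_1 by easy. pose proof (Gamma_pos c Hc) as HG.
  replace (/ (c * Gamma c)) with (/ Gamma c * (/ c * 1)) by (field; lra).
  apply is_lim_seq_ext with (fun n =>
    multichoose c n * Rpower (INR (S n)) (1 - c) * (/ c * ((INR n + c) / (INR n + 1)))).
  - intros n. rewrite <- S_INR. pose proof (INR_S_pos n).
    apply Rmult_eq_reg_r with c; [| lra].
    transitivity (multichoose (c + 1) n * c * Rpower (INR (S n)) (1 - (c + 1))); [| ring].
    rewrite multichoose_plus_1.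
    replace (1 - c) with (1 - (c + 1) + 1) by ring. rewrite Rpower_plus, Rpower_1 by easy.
    field. lra.
  - apply is_lim_seq_mult'; [exact IH |].
    apply (is_lim_seq_scal_l _ (/ c) 1), is_lim_seq_INR_ratio.
Qed.

Lemma multichoose_plus_1_scaled_le (y r : R) (n : nat) :
  0 <= y -> 0 < r -> 2 * r <= INR (S n) ->
  multichoose (y + 1) n * Rpower (INR (S n)) (- y) <= exp (2 * r) * Rpower r (- y).
Proof.
  intros Hy Hr Hn. pose proof (INR_S_pos n) as Hn0. set (u := r / INR (S n)).
  assert (Hu0 : 0 < u) by now apply Rdiv_lt_0_compat.
  assert (Hu : u <= / 2).
  { apply Rmult_le_reg_r with (INR (S n)); [easy |]. unfold u. field_simplify; lra. }
  assert (Hru : r = u * INR (S n)) by (unfold u; field; lra).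
  assert (Hexp : 1 <= exp (2 * r) * (1 - u) ^ n).
  { apply Rle_trans with (exp (2 * u) ^ n * (1 - u) ^ n).
    - rewrite <- Rpow_mult_distr. apply pow_R1_Rle.
      pose proof (exp_ineq1_le (2 * u)). nra.
    - apply Rmult_le_compat_r; [apply pow_le; lra |].
      rewrite <- Rpower_pow by apply exp_pos. unfold Rpower. rewrite ln_exp.
      apply exp_le. rewrite Hru, S_INR. nra. }
  pose proof (multichoose_plus_1_pow_le y (1 - u) n Hy ltac:(lra)) as H.
  replace (1 - (1 - u)) with u in H by ring.
  pose proof (multichoose_nonneg (y + 1) n ltac:(lra)).
  rewrite Hru at 2. rewrite <- Rpower_mult_distr by easy.
  pose proof (Rpower_pos (INR (S n)) (- y)). pose proof (exp_pos (2 * r)).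
  rewrite <- Rmult_assoc. apply Rmult_le_compat_r; [lra |].
  apply Rle_trans with (exp (2 * r) * (multichoose (y + 1) n * (1 - u) ^ n)); [nra |].
  apply Rmult_le_compat_l; lra.
Qed.

(** * The discrete Mittag-Leffler function *)

(* [dML a mu c n] is the coefficient of [z ^ n] in [(1 - z) ^ (a - c) / ((1 - z) ^ a + mu)].
   With [mu = x * h ^ a] and [c = 1] it is the convolution-quadrature approximation, at time
   [n * h], of the solution [ML a 1 (- x * t ^ a)] of the fractional relaxation equation. *)
Definition dML (a mu c : R) (n : nat) : R :=
  Series (fun k => (- mu) ^ k * multichoose (INR k * a + c) n).

Lemma ex_series_dML (a mu c : R) (n : nat) : 0 < a -> 0 <= mu < 1 -> 0 <= c ->
  ex_series (fun k => (- mu) ^ k * multichoose (INR k * a + c) n).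
Proof.
  intros Ha Hmu Hc. set (q := (1 + mu) / 2). set (s := Rpower q (/ a)).
  assert (Hq : 0 < q < 1) by (unfold q; lra).
  assert (Hs : 0 < s < 1).
  { split; [apply Rpower_pos |]. unfold s, Rpower. rewrite <- exp_0. apply exp_increasing.
    pose proof (ln_le_sub_1 q ltac:(lra)). pose proof (Rinv_0_lt_compat a Ha). nra. }
  assert (Hsa : forall k, Rpower s (INR k * a) = q ^ k).
  { intros k. unfold s. rewrite Rpower_mult, <- Rpower_pow by lra. f_equal. field. lra. }
  pose proof (pow_lt (1 - s) n ltac:(lra)) as Hsn.
  apply (@ex_series_le R_AbsRing R_CompleteNormedModule _
    (fun k => (mu / q) ^ k * (Rpower s (- c) / (1 - s) ^ n))).
  - intros k. assert (0 <= INR k * a) by (pose proof (pos_INR k); nra).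
    change (Rabs ((- mu) ^ k * multichoose (INR k * a + c) n) <=
      (mu / q) ^ k * (Rpower s (- c) / (1 - s) ^ n)).
    rewrite Rabs_mult, <- RPow_abs, Rabs_Ropp, (Rabs_pos_eq mu) by easy.
    rewrite Rabs_pos_eq by (apply multichoose_nonneg; lra).
    pose proof (multichoose_plus_1_pow_le (INR k * a + c) (1 - s) n ltac:(lra) ltac:(lra))
      as Hbound.
    replace (1 - (1 - s)) with s in Hbound by ring.
    rewrite Rpower_Ropp, Rpower_plus, Hsa in Hbound.
    pose proof (multichoose_le_plus_1 (INR k * a + c) n ltac:(lra)) as Hle.
    pose proof (pow_lt q k ltac:(lra)) as Hqk. pose proof (Rpower_pos s c).
    rewrite Rpower_Ropp. unfold Rdiv at 1. rewrite Rpow_mult_distr, pow_inv, Rmult_assoc.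
    apply Rmult_le_compat_l; [apply pow_le; lra |].
    apply Rmult_le_reg_r with ((1 - s) ^ n); [easy |].
    apply Rle_trans with (/ (q ^ k * Rpower s c)); [nra | right; field; lra].
  - apply ex_series_scal_r, ex_series_geom.
    rewrite Rabs_pos_eq by (apply Rdiv_le_0_compat; lra).
    apply Rmult_lt_reg_r with q; [lra |]. unfold q. field_simplify; lra.
Qed.

Lemma is_series_sum_f_R0 (F : nat -> nat -> R) (l : nat -> R) (n : nat) :
  (forall j, is_series (F j) (l j)) ->
  is_series (fun k => sum_f_R0 (fun j => F j k) n) (sum_f_R0 l n).
Proof.
  intros HF. induction n as [| n IH]; [apply HF |].
  exact (is_series_plus _ _ _ _ IH (HF (S n))).
Qed.

Section DiscreteMittagLeffler.

Variables a mu : R.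
Hypothesis Ha : 0 < a.
Hypothesis Ha1 : a <= 1.
Hypothesis Hmu : 0 <= mu < 1.

Lemma PS_mult_dML (c : R) (b : nat -> R) (n : nat) : 0 <= c ->
  PS_mult b (dML a mu c) n =
  Series (fun k => (- mu) ^ k * PS_mult b (multichoose (INR k * a + c)) n).
Proof.
  intros Hc. symmetry. apply is_series_unique.
  eapply is_series_ext; [| apply (is_series_sum_f_R0
    (fun j k => b j * ((- mu) ^ k * multichoose (INR k * a + c) (n - j))))].
  - intros k. unfold PS_mult. rewrite scal_sum. apply sum_eq. intros; ring.
  - intros j. apply (is_series_scal (V := R_NormedModule) (b j) _ (dML a mu c (n - j))).
    apply Series_correct, ex_series_dML; easy.
Qed.

Lemma PS_mult_multichoose_dML (c d : R) (n : nat) : 0 <= c ->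
  PS_mult (multichoose d) (dML a mu c) n = dML a mu (d + c) n.
Proof.
  intros Hc. rewrite PS_mult_dML by easy. apply Series_ext. intros k.
  rewrite PS_mult_multichoose. do 2 f_equal. ring.
Qed.

Lemma dML_shift (c : R) (n : nat) : 0 <= c ->
  dML a mu c n = multichoose c n - mu * dML a mu (a + c) n.
Proof.
  intros Hc. unfold dML. rewrite Series_incr_1 by (apply ex_series_dML; easy).
  simpl (INR 0). rewrite Rmult_0_l, Rplus_0_l, pow_O, Rmult_1_l.
  rewrite <- Series_scal_l. unfold Rminus. rewrite <- Series_opp. f_equal.
  apply Series_ext. intros k. rewrite S_INR.
  replace ((INR k + 1) * a + c) with (INR k * a + (a + c)) by ring. simpl. ring.
Qed.

(* [(1 + mu) dML a mu a n] is a combination of the earlier values with coefficients those of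
   [1 - (1 - z) ^ a], which are nonnegative. *)
Lemma dML_resolvent_nonneg (n : nat) : 0 <= dML a mu a n.
Proof.
  assert (Hconv : forall m, PS_mult (multichoose (- a)) (dML a mu a) m =
    multichoose 0 m - mu * dML a mu a m).
  { intros m. rewrite PS_mult_multichoose_dML, Rplus_opp_l, dML_shift, Rplus_0_r by lra.
    reflexivity. }
  induction n as [n IH] using lt_wf_ind.
  apply Rmult_le_reg_l with (1 + mu); [lra |]. rewrite Rmult_0_r.
  specialize (Hconv n). unfold PS_mult in Hconv. destruct n as [| n].
  - simpl in Hconv. lra.
  - rewrite decomp_sum, multichoose_0_S in Hconv by lia. simpl Init.Nat.pred in Hconv.
    replace ((1 + mu) * dML a mu a (S n)) with
      (- sum_f_R0 (fun k => multichoose (- a) (S k) * dML a mu a (S n - S k)) n)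
      by (simpl multichoose at 1 in Hconv; rewrite Nat.sub_0_r in Hconv; lra).
    enough (sum_f_R0 (fun k => multichoose (- a) (S k) * dML a mu a (S n - S k)) n <=
      sum_f_R0 (fun _ => 0) n) by (rewrite (sum_eq_R0 (fun _ => 0)) in * by easy; lra).
    apply sum_Rle. intros k Hk.
    pose proof (multichoose_opp_nonpos a k ltac:(lra)).
    pose proof (IH (S n - S k)%nat ltac:(lia)). nra.
Qed.

Lemma sum_dML (c : R) (n : nat) : 0 <= c ->
  sum_f_R0 (dML a mu c) n = dML a mu (1 + c) n.
Proof.
  intros Hc. now rewrite <- PS_mult_multichoose_1, PS_mult_comm, PS_mult_multichoose_dML.
Qed.

Lemma dML_1_eq (n : nat) :
  dML a mu 1 n = PS_mult (multichoose (1 - a)) (dML a mu a) n.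
Proof. rewrite PS_mult_multichoose_dML by lra. f_equal. ring. Qed.

Lemma dML_1_complement (n : nat) : 1 - dML a mu 1 n = mu * sum_f_R0 (dML a mu a) n.
Proof.
  rewrite sum_dML, dML_shift, multichoose_1, (Rplus_comm a) by lra. ring.
Qed.

Lemma dML_1_decreasing : Un_decreasing (dML a mu 1).
Proof.
  intros n. pose proof (dML_1_complement n) as Hn.
  pose proof (dML_1_complement (S n)) as HSn. rewrite tech5 in HSn.
  pose proof (dML_resolvent_nonneg (S n)). nra.
Qed.

Lemma dML_1_lower (n : nat) :
  multichoose (1 - a) n * (1 - dML a mu 1 n) <= mu * dML a mu 1 n.
Proof.
  rewrite dML_1_complement, dML_1_eq.
  pose proof (PS_mult_decreasing_ge _ _ n
    (multichoose_decreasing (1 - a) ltac:(lra)) dML_resolvent_nonneg). nra.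
Qed.

Lemma dML_1_upper (n : nat) :
  dML a mu 1 n * (1 + mu * multichoose (a + 1) n) <= 1.
Proof.
  enough (dML a mu 1 n * multichoose (a + 1) n <= sum_f_R0 (dML a mu a) n)
    by (pose proof (dML_1_complement n); nra).
  rewrite sum_dML, <- sum_multichoose, Rplus_comm, <- PS_mult_multichoose_dML, PS_mult_comm
    by lra.
  apply PS_mult_decreasing_ge; [exact dML_1_decreasing |].
  intros k. apply multichoose_nonneg. lra.
Qed.

End DiscreteMittagLeffler.

Section ResolventIdentity.

Variables a mu nu : R.
Hypothesis Ha : 0 < a.
Hypothesis Ha1 : a <= 1.
Hypothesis Hmu : 0 <= mu < 1.
Hypothesis Hnu : 0 <= nu < 1.

Lemma PS_mult_dML_dML (c d : R) (n : nat) : 0 <= c -> 0 <= d ->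
  PS_mult (dML a mu c) (dML a nu d) n =
  Series (fun k => (- nu) ^ k * dML a mu (INR k * a + (c + d)) n).
Proof.
  intros Hc Hd. rewrite PS_mult_dML by easy. apply Series_ext. intros k.
  rewrite PS_mult_comm, PS_mult_multichoose_dML by easy. do 2 f_equal. ring.
Qed.

(* Expand both sides of the identity
   [(1 - z) ^ (a - 1) / ((1 - z) ^ a + mu) * ((1 - z) ^ a / ((1 - z) ^ a + nu)) =
    (1 - z) ^ (2 a - 1) / ((1 - z) ^ a + mu) * (1 / ((1 - z) ^ a + nu))]. *)
Lemma dML_1_sub (n : nat) :
  dML a mu 1 n - dML a nu 1 n = (nu - mu) * PS_mult (dML a mu 1) (dML a nu a) n.
Proof.
  assert (Hshift : PS_mult (dML a mu 1) (dML a nu 0) n =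
    PS_mult (dML a mu (1 - a)) (dML a nu a) n).
  { rewrite !PS_mult_dML_dML by lra. apply Series_ext. intros k. do 2 f_equal. ring. }
  assert (Hleft : PS_mult (dML a mu 1) (dML a nu 0) n =
    dML a mu 1 n - nu * PS_mult (dML a mu 1) (dML a nu a) n).
  { rewrite (PS_mult_ext_r _ _ (fun k => multichoose 0 k - nu * dML a nu a k)).
    - rewrite PS_mult_sub_scal, PS_mult_comm, PS_mult_multichoose_dML, Rplus_0_l by lra.
      reflexivity.
    - intros k. rewrite dML_shift, Rplus_0_r by lra. reflexivity. }
  assert (Hright : PS_mult (dML a mu (1 - a)) (dML a nu a) n =
    dML a nu 1 n - mu * PS_mult (dML a mu 1) (dML a nu a) n).
  { rewrite PS_mult_comm, (PS_mult_ext_r _ _ (fun k => multichoose (1 - a) k - mu * dML a mu 1 k)).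
    - rewrite PS_mult_sub_scal, (PS_mult_comm _ (dML a mu 1)), PS_mult_comm.
      now rewrite <- dML_1_eq.
    - intros k. rewrite dML_shift by lra. do 3 f_equal. ring. }
  lra.
Qed.

Lemma dML_1_sub_ge (n : nat) : mu <= nu ->
  (nu - mu) * dML a mu 1 n * (1 - dML a nu 1 n) <= nu * (dML a mu 1 n - dML a nu 1 n).
Proof.
  intros Hmunu. rewrite dML_1_sub, (dML_1_complement a nu) by easy.
  pose proof (PS_mult_decreasing_ge _ _ n (dML_1_decreasing a mu Ha Ha1 Hmu)
    (dML_resolvent_nonneg a nu Ha Ha1 Hnu)) as H.
  apply Rmult_le_compat_l with (r := nu * (nu - mu)) in H; [lra | nra].
Qed.

End ResolventIdentity.

(** * Convergence to the Mittag-Leffler function *)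

Lemma is_lim_seq_sum_f_R0 (u : nat -> nat -> R) (l : nat -> R) (K : nat) :
  (forall k, is_lim_seq (fun n => u n k) (l k)) ->
  is_lim_seq (fun n => sum_f_R0 (u n) K) (sum_f_R0 l K).
Proof.
  intros H. induction K as [| K IH]; [apply H |].
  exact (is_lim_seq_plus' _ _ _ _ IH (H (S K))).
Qed.

Lemma Series_remainder_le (u M : nat -> R) (K : nat) :
  (forall k, Rabs (u k) <= M k) -> ex_series M ->
  Rabs (Series u - sum_f_R0 u K) <= Series M - sum_f_R0 M K.
Proof.
  intros Hu HM.
  assert (Hex : ex_series u)
    by now apply (@ex_series_le R_AbsRing R_CompleteNormedModule _ M).
  refine (sum_maj1 (fun k _ => u k) M 0 _ _ K _ _ Hu);
    apply is_series_Reals, Series_correct; easy.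
Qed.

Lemma is_lim_seq_Series_dominated (u : nat -> nat -> R) (l M : nat -> R) :
  (forall k, is_lim_seq (fun n => u n k) (l k)) ->
  eventually (fun n => forall k, Rabs (u n k) <= M k) ->
  ex_series M ->
  is_lim_seq (fun n => Series (u n)) (Series l).
Proof.
  intros Hl HuM HM.
  assert (HlM : forall k, Rabs (l k) <= M k).
  { intros k. refine (is_lim_seq_le_loc (fun n => Rabs (u n k)) (fun _ => M k)
      (Rabs (l k)) (M k) _ (is_lim_seq_abs _ (Finite (l k)) (Hl k)) (is_lim_seq_const _)).
    revert HuM. now apply filter_imp. }
  apply is_lim_seq_spec. intros eps.
  assert (He : 0 < eps / 3) by (pose proof (cond_pos eps); lra).
  destruct (proj1 (is_series_Reals _ _) (Series_correct _ HM) (eps / 3) He) as [K HK].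
  specialize (HK K (le_n K)). apply Rabs_def2 in HK.
  pose proof (proj2 (is_lim_seq_spec _ _) (is_lim_seq_sum_f_R0 u l K Hl) (mkposreal _ He))
    as Hsum.
  generalize (filter_and _ _ HuM Hsum). apply filter_imp. simpl. intros n [Hun Hsumn].
  pose proof (Series_remainder_le (u n) M K Hun HM) as Hu.
  pose proof (Series_remainder_le l M K HlM HM) as Hl'.
  apply Rabs_def2 in Hsumn. apply Rabs_le_between in Hu, Hl'.
  apply Rabs_def1; lra.
Qed.

Lemma dML_summand_scaled (a x : R) (n k : nat) :
  (- (x * Rpower (INR (S n)) (- a))) ^ k * multichoose (INR k * a + 1) n =
  (- x) ^ k * (multichoose (INR k * a + 1) n * Rpower (INR (S n)) (- (INR k * a))).
Proof.
  rewrite Ropp_mult_distr_l, Rpow_mult_distr, <- (Rpower_pow k (Rpower _ _)) by apply Rpower_pos.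
  rewrite Rpower_mult. replace (- a * INR k) with (- (INR k * a)) by ring. ring.
Qed.

Lemma is_lim_seq_dML_1 (a x : R) : 0 < a -> 0 < x ->
  is_lim_seq (fun n => dML a (x * Rpower (INR (S n)) (- a)) 1 n) (ML a 1 (- x)).
Proof.
  intros Ha Hx. set (r := Rpower (2 * x) (/ a)).
  assert (Hr : 0 < r) by apply Rpower_pos.
  assert (Hrk : forall k, Rpower r (- (INR k * a)) = / (2 * x) ^ k).
  { intros k. rewrite Rpower_Ropp. unfold r. rewrite Rpower_mult, <- Rpower_pow by lra.
    do 2 f_equal. field. lra. }
  assert (Hka : forall k, 0 <= INR k * a) by (intros k; pose proof (pos_INR k); nra).
  apply (is_lim_seq_Series_dominated _ _ (fun k => exp (2 * r) * (/ 2) ^ k)).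
  - intros k. apply is_lim_seq_ext with (fun n => (- x) ^ k *
      (multichoose (INR k * a + 1) n * Rpower (INR (S n)) (1 - (INR k * a + 1)))).
    + intros n. rewrite dML_summand_scaled. do 3 f_equal. ring.
    + apply (is_lim_seq_scal_l _ ((- x) ^ k) (/ Gamma (INR k * a + 1))).
      apply is_lim_seq_multichoose. specialize (Hka k). lra.
  - destruct (INR_unbounded (2 * r)) as [N HN]. exists N. intros n Hn k.
    apply le_INR in Hn. specialize (Hka k).
    rewrite dML_summand_scaled, Rabs_mult, <- RPow_abs, Rabs_Ropp, (Rabs_pos_eq x) by lra.
    rewrite Rabs_pos_eq
      by (apply Rmult_le_pos; [apply multichoose_nonneg; lra | left; apply Rpower_pos]).
    pose proof (multichoose_plus_1_scaled_le (INR k * a) r n Hka Hr) as H.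
    rewrite Hrk, S_INR in H. rewrite S_INR. specialize (H ltac:(lra)).
    pose proof (pow_lt x k Hx) as Hxk. pose proof (pow_lt 2 k Rlt_0_2).
    apply Rmult_le_compat_l with (r := x ^ k) in H; [| lra].
    eapply Rle_trans; [exact H |]. right. rewrite Rpow_mult_distr, pow_inv. field. lra.
  - apply (ex_series_scal (V := R_NormedModule) (exp (2 * r))), ex_series_geom.
    rewrite Rabs_pos_eq; lra.
Qed.

Lemma eventually_scaled_unit (a x : R) : 0 < a -> 0 < x ->
  eventually (fun n => 0 <= x * Rpower (INR (S n)) (- a) < 1).
Proof.
  intros Ha Hx. destruct (INR_unbounded (Rpower x (/ a))) as [N HN].
  exists N. intros n Hn. apply le_INR in Hn. rewrite S_INR.
  pose proof (Rpower_pos x (/ a)). pose proof (Rpower_pos (INR n + 1) a).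
  rewrite Rpower_Ropp. split; [left; now apply Rdiv_lt_0_compat |].
  apply Rmult_lt_reg_r with (Rpower (INR n + 1) a); [easy |].
  rewrite Rmult_assoc, Rinv_l, Rmult_1_r, Rmult_1_l by lra.
  apply Rle_lt_trans with (Rpower (Rpower x (/ a)) a).
  - rewrite Rpower_mult, Rinv_l, Rpower_1 by lra. lra.
  - apply Rlt_Rpower_l; lra.
Qed.

(** * The Mittag-Leffler function on the negative half-line *)

Section MittagLeffler.

Variable a : R.
Hypothesis Ha : 0 < a.
Hypothesis Ha1 : a < 1.

Lemma ML_opp_ge (x : R) : 0 < x -> / (1 + Gamma (1 - a) * x) <= ML a 1 (- x).
Proof.
  intros Hx. pose proof (is_lim_seq_dML_1 a x Ha Hx) as Hlim.
  pose proof (Gamma_pos (1 - a) ltac:(lra)) as HG.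
  assert (H : / Gamma (1 - a) * (1 - ML a 1 (- x)) <= x * ML a 1 (- x)).
  { refine (is_lim_seq_le_loc
      (fun n => multichoose (1 - a) n * Rpower (INR (S n)) (1 - (1 - a)) *
                (1 - dML a (x * Rpower (INR (S n)) (- a)) 1 n))
      (fun n => x * dML a (x * Rpower (INR (S n)) (- a)) 1 n)
      (/ Gamma (1 - a) * (1 - ML a 1 (- x))) (x * ML a 1 (- x)) _ _
      (is_lim_seq_scal_l _ x _ Hlim)).
    - generalize (eventually_scaled_unit a x Ha Hx). apply filter_imp.
      intros n Hn. pose proof (dML_1_lower a _ Ha (Rlt_le _ _ Ha1) Hn n) as H.
      replace (1 - (1 - a)) with a by ring. rewrite Rpower_Ropp in *.
      pose proof (Rpower_pos (INR (S n)) a) as Hpow.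
      apply Rmult_le_compat_l with (r := Rpower (INR (S n)) a) in H; [| lra].
      eapply Rle_trans; [| eapply Rle_trans; [exact H |]]; right; [ring | field; lra].
    - apply is_lim_seq_mult'; [apply is_lim_seq_multichoose; lra |].
      apply is_lim_seq_minus'; [apply is_lim_seq_const | exact Hlim]. }
  assert (HGx : 0 < Gamma (1 - a) * x) by now apply Rmult_lt_0_compat.
  apply Rmult_le_reg_l with (1 + Gamma (1 - a) * x); [lra |]. rewrite Rinv_r by lra.
  apply Rmult_le_compat_l with (r := Gamma (1 - a)) in H; [| lra].
  rewrite <- Rmult_assoc, Rinv_r in H by lra. lra.
Qed.

Lemma ML_opp_pos (x : R) : 0 < x -> 0 < ML a 1 (- x).
Proof.
  intros Hx. pose proof (Gamma_pos (1 - a) ltac:(lra)).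
  eapply Rlt_le_trans; [| now apply ML_opp_ge]. apply Rinv_0_lt_compat. nra.
Qed.

Lemma ML_opp_le (x : R) : 0 < x -> ML a 1 (- x) <= / (1 + x / Gamma (a + 1)).
Proof.
  intros Hx. pose proof (is_lim_seq_dML_1 a x Ha Hx) as Hlim.
  assert (Hpos : 0 < x / Gamma (a + 1)) by (apply Rdiv_lt_0_compat, Gamma_pos; lra).
  apply Rmult_le_reg_r with (1 + x / Gamma (a + 1)); [lra |]. rewrite Rinv_l by lra.
  refine (is_lim_seq_le_loc
    (fun n => dML a (x * Rpower (INR (S n)) (- a)) 1 n *
              (1 + x * (multichoose (a + 1) n * Rpower (INR (S n)) (1 - (a + 1))))) (fun _ => 1)
    (ML a 1 (- x) * (1 + x / Gamma (a + 1))) 1 _ _ (is_lim_seq_const 1)).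
  - generalize (eventually_scaled_unit a x Ha Hx). apply filter_imp.
    intros n Hn. replace (1 - (a + 1)) with (- a) by ring.
    eapply Rle_trans; [| exact (dML_1_upper a _ Ha (Rlt_le _ _ Ha1) Hn n)]. right. ring.
  - apply is_lim_seq_mult'; [exact Hlim |].
    apply is_lim_seq_plus'; [apply is_lim_seq_const |].
    apply (is_lim_seq_scal_l _ x (/ Gamma (a + 1))), is_lim_seq_multichoose. lra.
Qed.

Lemma ML_opp_sub_ge (x y : R) : 0 < x -> x <= y ->
  (y - x) * ML a 1 (- x) * (1 - ML a 1 (- y)) <= y * (ML a 1 (- x) - ML a 1 (- y)).
Proof.
  intros Hx Hxy. assert (Hy : 0 < y) by lra.
  pose proof (is_lim_seq_dML_1 a x Ha Hx) as Hlimx.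
  pose proof (is_lim_seq_dML_1 a y Ha Hy) as Hlimy.
  refine (is_lim_seq_le_loc
    (fun n => (y - x) * dML a (x * Rpower (INR (S n)) (- a)) 1 n *
              (1 - dML a (y * Rpower (INR (S n)) (- a)) 1 n))
    (fun n => y * (dML a (x * Rpower (INR (S n)) (- a)) 1 n -
                   dML a (y * Rpower (INR (S n)) (- a)) 1 n))
    ((y - x) * ML a 1 (- x) * (1 - ML a 1 (- y)))
    (y * (ML a 1 (- x) - ML a 1 (- y))) _ _ _).
  - generalize (filter_and _ _ (eventually_scaled_unit a x Ha Hx)
      (eventually_scaled_unit a y Ha Hy)). apply filter_imp. intros n [Hnx Hny].
    pose proof (Rpower_pos (INR (S n)) (- a)) as Hpow.
    apply Rmult_le_reg_l with (Rpower (INR (S n)) (- a)); [easy |].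
    pose proof (dML_1_sub_ge a _ _ Ha (Rlt_le _ _ Ha1) Hnx Hny n
      (Rmult_le_compat_r _ _ _ (Rlt_le _ _ Hpow) Hxy)). lra.
  - apply is_lim_seq_mult'.
    + exact (is_lim_seq_scal_l _ (y - x) _ Hlimx).
    + apply is_lim_seq_minus'; [apply is_lim_seq_const | exact Hlimy].
  - exact (is_lim_seq_scal_l _ y _ (is_lim_seq_minus' _ _ _ _ Hlimx Hlimy)).
Qed.

Lemma ML_opp_mul_le (x : R) : 0 < x -> x * ML a 1 (- x) <= Gamma (a + 1).
Proof.
  intros Hx. pose proof (Gamma_pos (a + 1) ltac:(lra)) as HG.
  assert (Hpos : 0 < x / Gamma (a + 1)) by now apply Rdiv_lt_0_compat.
  apply Rle_trans with (x * / (1 + x / Gamma (a + 1)));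
    [apply Rmult_le_compat_l; [lra | now apply ML_opp_le] |].
  apply Rmult_le_reg_r with (1 + x / Gamma (a + 1)); [lra |].
  rewrite Rmult_assoc, Rinv_l by lra. field_simplify; lra.
Qed.

Lemma ML_opp_scaled_mul_bounds (p s x : R) : 0 < p <= s -> 0 < x ->
  0 <= x * ML a 1 (- (s * x)) <= Gamma (a + 1) / p.
Proof.
  intros Hps Hx. assert (Hsx : 0 < s * x) by (apply Rmult_lt_0_compat; lra).
  pose proof (ML_opp_pos _ Hsx). pose proof (ML_opp_mul_le _ Hsx).
  assert (Hpos : 0 <= x * ML a 1 (- (s * x))) by (apply Rmult_le_pos; lra).
  split; [exact Hpos |]. apply Rmult_le_reg_l with p; [lra |].
  replace (p * (Gamma (a + 1) / p)) with (Gamma (a + 1)) by (field; lra).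
  apply Rle_trans with (s * (x * ML a 1 (- (s * x)))); [apply Rmult_le_compat_r; lra | lra].
Qed.

Lemma ML_opp_mul_ge (x : R) : 1 <= x -> / (1 + Gamma (1 - a)) <= x * ML a 1 (- x).
Proof.
  intros Hx. pose proof (Gamma_pos (1 - a) ltac:(lra)) as HG.
  apply Rle_trans with (x * / (1 + Gamma (1 - a) * x));
    [| apply Rmult_le_compat_l; [lra | apply ML_opp_ge; lra]].
  assert (0 < 1 + Gamma (1 - a) * x) by nra.
  apply Rmult_le_reg_r with ((1 + Gamma (1 - a)) * (1 + Gamma (1 - a) * x)); [nra |].
  field_simplify; nra.
Qed.

Lemma ML_opp_le_half (x : R) : Gamma (a + 1) <= x -> ML a 1 (- x) <= / 2.
Proof.
  intros Hx. pose proof (Gamma_pos (a + 1) ltac:(lra)) as HG.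
  eapply Rle_trans; [apply ML_opp_le; lra |]. apply Rinv_le_contravar; [lra |].
  apply Rmult_le_reg_r with (Gamma (a + 1)); [lra |]. field_simplify; lra.
Qed.

Lemma ML_opp_sub_mul_ge (p q : R) : 0 < p < q ->
  exists c X, 0 < c /\ 0 < X /\
    forall x, X <= x -> c <= x * (ML a 1 (- (p * x)) - ML a 1 (- (q * x))).
Proof.
  intros Hpq. set (G := / (1 + Gamma (1 - a))).
  pose proof (Gamma_pos (a + 1) ltac:(lra)) as HG1.
  assert (HG : 0 < G)
    by (pose proof (Gamma_pos (1 - a) ltac:(lra)); apply Rinv_0_lt_compat; lra).
  assert (Hp : 0 < / p) by (apply Rinv_0_lt_compat; lra).
  assert (HGq : 0 < Gamma (a + 1) / q) by (apply Rdiv_lt_0_compat; lra).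
  exists ((q - p) * G / (2 * p * q)), (/ p + Gamma (a + 1) / q). repeat split; [| lra |].
  { apply Rdiv_lt_0_compat; [apply Rmult_lt_0_compat; lra | nra]. }
  intros x Hx.
  assert (Hpx : 1 <= p * x).
  { rewrite <- (Rinv_r p) by lra. apply Rmult_le_compat_l; lra. }
  assert (Hqx : Gamma (a + 1) <= q * x).
  { replace (Gamma (a + 1)) with (q * (Gamma (a + 1) / q)) by (field; lra).
    apply Rmult_le_compat_l; lra. }
  pose proof (ML_opp_mul_ge (p * x) Hpx) as Hlow. fold G in Hlow.
  pose proof (ML_opp_le_half (q * x) Hqx) as Hhalf.
  pose proof (ML_opp_sub_ge (p * x) (q * x) ltac:(lra) ltac:(nra)) as Hsub.
  set (Ep := ML a 1 (- (p * x))) in *. set (Eq := ML a 1 (- (q * x))) in *.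
  assert (Hprod : G * / 2 <= p * x * Ep * (1 - Eq)) by (apply Rmult_le_compat; lra).
  apply Rmult_le_reg_l with (p * q); [nra |].
  apply Rle_trans with ((q - p) * (G * / 2)); [right; field; lra |].
  apply Rle_trans with ((q - p) * (p * x * Ep * (1 - Eq)));
    [apply Rmult_le_compat_l; lra |].
  apply Rmult_le_compat_l with (r := p) in Hsub; lra.
Qed.

End MittagLeffler.

(** * Uniqueness *)

Lemma dirichlet_spectrum_pos (lam : nat -> R) (n : nat) : dirichlet_spectrum lam -> 0 < lam n.
Proof.
  intros (H0 & Hincr & _). induction n as [| n IH]; [easy |]. specialize (Hincr n). lra.
Qed.

Lemma solP_inj_initial (alpha : R) (lam u u' f : nat -> R) (T : R) (n : nat) :
  0 < alpha < 1 -> 0 < lam n ->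
  solP alpha lam u f T n = solP alpha lam u' f T n -> u n = u' n.
Proof.
  unfold solP. intros Ha Hlam Heq.
  pose proof (ML_opp_pos alpha (proj1 Ha) (proj2 Ha) (lam n * Rpower T alpha)
    (Rmult_lt_0_compat _ _ Hlam (Rpower_pos T alpha))) as Hpos.
  rewrite Ropp_mult_distr_l in Hpos.
  apply Rmult_eq_reg_l with (ML alpha 1 (- lam n * Rpower T alpha)); lra.
Qed.

Lemma solP_eq_source (alpha : R) (lam u u' f : nat -> R) (T T' : R) (n : nat) :
  let E t := ML alpha 1 (- (Rpower t alpha * lam n)) in
  lam n <> 0 -> solP alpha lam u f T n = solP alpha lam u' f T' n ->
  lam n * (E T - E T') * f n = lam n * (lam n * E T * u n - lam n * E T' * u' n).
Proof.
  intros E Hlam Heq. unfold solP in Heq.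
  rewrite !(Rmult_comm (- lam n)), !Ropp_mult_distr_r_reverse in Heq. fold (E T) (E T') in Heq.
  transitivity (lam n ^ 2 * (/ lam n * (E T - E T') * f n)); [field; easy |].
  transitivity (lam n ^ 2 * (E T * u n - E T' * u' n)); [f_equal; lra | ring].
Qed.

Lemma solP_eq_source_le (alpha T T' : R) : 0 < alpha < 1 -> 0 < T < T' ->
  exists C X, 0 < X /\
    forall lam u u' f n, X <= lam n -> solP alpha lam u f T n = solP alpha lam u' f T' n ->
      Rabs (f n) <= C * (lam n * (Rabs (u n) + Rabs (u' n))).
Proof.
  intros [Ha Ha1] HT. set (p := Rpower T alpha). set (q := Rpower T' alpha).
  assert (Hpq : 0 < p < q) by (split; [apply Rpower_pos | apply Rlt_Rpower_l; lra]).
  destruct (ML_opp_sub_mul_ge alpha Ha Ha1 p q Hpq) as (c & X & Hc & HX & Hsub).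
  set (C := Gamma (alpha + 1) / p).
  exists (C / c), X. split; [easy |]. intros lam u u' f n Hlam Heq.
  specialize (Hsub (lam n) Hlam).
  apply solP_eq_source in Heq; [| lra]. fold p q in Heq.
  pose proof (ML_opp_scaled_mul_bounds alpha Ha Ha1 p p (lam n) ltac:(lra) ltac:(lra)) as Hp.
  pose proof (ML_opp_scaled_mul_bounds alpha Ha Ha1 p q (lam n) ltac:(lra) ltac:(lra)) as Hq.
  fold C in Hp, Hq. set (Ep := ML alpha 1 (- (p * lam n))) in *.
  set (Eq := ML alpha 1 (- (q * lam n))) in *.
  assert (Hstate : Rabs (lam n * Ep * u n - lam n * Eq * u' n) <=
    C * (Rabs (u n) + Rabs (u' n))).
  { unfold Rminus. eapply Rle_trans; [apply Rabs_triang |].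
    rewrite Rabs_Ropp, (Rabs_mult (lam n * Ep)), (Rabs_mult (lam n * Eq)).
    rewrite (Rabs_pos_eq (lam n * Ep)), (Rabs_pos_eq (lam n * Eq)) by easy.
    rewrite Rmult_plus_distr_l.
    apply Rplus_le_compat; apply Rmult_le_compat_r; easy || apply Rabs_pos. }
  apply Rmult_le_reg_l with c; [easy |].
  apply Rle_trans with (Rabs (lam n * (Ep - Eq) * f n)).
  - rewrite Rabs_mult. apply Rmult_le_compat_r; [apply Rabs_pos |].
    eapply Rle_trans; [exact Hsub | apply Rle_abs].
  - rewrite Heq, Rabs_mult, (Rabs_pos_eq (lam n)) by lra.
    replace (c * _) with (lam n * (C * (Rabs (u n) + Rabs (u' n)))) by (field; lra).
    apply Rmult_le_compat_l; lra.
Qed.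

Lemma in_S_of_le (lam : nat -> R) (g C : R) (u u' f : nat -> R) :
  in_Hdot_m2 lam f -> in_S lam (g + 1) u -> in_S lam (g + 1) u' ->
  eventually (fun n => 0 < lam n /\
    Rabs (f n) <= C * (lam n * (Rabs (u n) + Rabs (u' n)))) ->
  in_S lam g f.
Proof.
  intros Hf [_ Hu] [_ Hu'] Hle. split; [exact Hf |].
  apply (is_lim_seq_le_le_loc (fun _ => 0) _
    (fun n => C * (Rpower (lam n) (g + 1) * Rabs (u n) +
                   Rpower (lam n) (g + 1) * Rabs (u' n)))).
  - revert Hle. apply filter_imp. intros n [Hlam Hfn].
    pose proof (Rpower_pos (lam n) g) as Hpow.
    split; [apply Rmult_le_pos; [lra | apply Rabs_pos] |].
    rewrite Rpower_plus, Rpower_1 by easy.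
    apply Rmult_le_compat_l with (r := Rpower (lam n) g) in Hfn; lra.
  - apply is_lim_seq_const.
  - replace (Finite 0) with (Rbar_mult C (0 + 0)) by (simpl; f_equal; ring).
    apply is_lim_seq_scal_l. now apply is_lim_seq_plus'.
Qed.

Lemma solP_eq_not_lt (alpha : R) (lam : nat -> R) (g : R) (f u u' : nat -> R) (T T' : R) :
  0 < alpha < 1 -> is_lim_seq lam p_infty ->
  in_Hdot_m2 lam f -> ~ in_S lam g f -> in_S lam (g + 1) u -> in_S lam (g + 1) u' ->
  0 < T -> (forall n, solP alpha lam u f T n = solP alpha lam u' f T' n) -> ~ T < T'.
Proof.
  intros Ha Hlam Hf HnS Hu Hu' HT Heq Hlt. apply HnS.
  destruct (solP_eq_source_le alpha T T' Ha (conj HT Hlt)) as (C & X & HX & Hle).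
  apply (in_S_of_le lam g C u u'); [easy | easy | easy |].
  generalize (proj2 (is_lim_seq_spec _ _) Hlam X). apply filter_imp. intros n HXn.
  split; [lra |]. apply Hle; [lra | apply Heq].
Qed.

Theorem mainTheorem1 (alpha : R) (lam : nat -> R) (g : R) (f u0 u0' : nat -> R) (T T' : R) :
  0 < alpha < 1 ->
  dirichlet_spectrum lam ->
  0 <= g ->
  in_Hdot_m2 lam f -> ~ in_S lam g f ->
  0 < T -> 0 < T' ->
  in_L2 u0 -> in_S lam (g + 1) u0 ->
  in_L2 u0' -> in_S lam (g + 1) u0' ->
  (forall n, solP alpha lam u0 f T n = solP alpha lam u0' f T' n) ->
  T = T' /\ (forall n, u0 n = u0' n).
Proof.
  intros Ha Hspec _ Hf HnS HT HT' _ Hu _ Hu' Heq.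
  assert (Hlam : is_lim_seq lam p_infty) by apply Hspec.
  assert (HTT : T = T').
  { apply Rle_antisym; apply Rnot_lt_le.
    - now apply (solP_eq_not_lt alpha lam g f u0' u0).
    - now apply (solP_eq_not_lt alpha lam g f u0 u0'). }
  split; [exact HTT |]. subst T'. intros n.
  apply (solP_inj_initial alpha lam u0 u0' f T); [easy | now apply dirichlet_spectrum_pos |].
  apply Heq.
Qed.
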